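(* Let $m,n\ge 1$, let $A_1,\dots,A_n\in\mathbb{R}^{m\times m}$ be square entrywise non-negative matrices, each with at least one non-zero entry in every row, and let $u_1,\dots,u_n\in\mathbb{R}^m$ be strictly positive vectors. Then the product $$\prod_{i=1}^n A_i D(u_i) = A_1D(u_1)A_2D(u_2)\cdots A_nD(u_n)$$ can be written as $D(u_{1:n})P_{1:n}$, where $P_{1:n}\in\mathbb{R}^{m\times m}$ is a stochastic matrix and $u_{1:n}\in\mathbb{R}^m$ is a positive vector (all entries $>0$).
   Context: For a vector $x$, $D(x)$ is the diagonal matrix with $x$ on its diagonal. A square matrix is stochastic if its entries are non-negative and each row sums to $1$. *)

(* Defs.v *)
From mathcomp Require Import all_boot all_order all_algebra.
From mathcomp Require Import reals.

Set Implicit Arguments.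
Unset Strict Implicit.
Unset Printing Implicit Defensive.

Import GRing.Theory Num.Theory.
Local Open Scope ring_scope.

Definition nonneg_mx (R : realType) (m : nat) (A : 'M[R]_m) : Prop :=
  forall i j, 0 <= A i j.

(* Vectors are row vectors because diag_mx, which plays the role of D,
   takes a row vector. *)
Definition pos_vec (R : realType) (m : nat) (u : 'rV[R]_m) : Prop :=
  forall j, 0 < u 0 j.

Definition stochastic (R : realType) (m : nat) (P : 'M[R]_m) : Prop :=
  nonneg_mx P /\ (forall i, \sum_j P i j = 1).

(* Main.v *)
(** Entrywise non-negative matrices without zero rows are closed under
    products, and any such matrix factors through its vector of row sums. *)

Require Import Defs.
From mathcomp Require Import all_boot all_order all_algebra.
From mathcomp Require Import reals.

Set Implicit Arguments.
Unset Strict Implicit.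
Unset Printing Implicit Defensive.

Import Order.TTheory GRing.Theory Num.Theory.
Local Open Scope ring_scope.

(** A non-negative matrix with a positive entry in every row has positive row sums, and dividing
    each row by its sum leaves a stochastic matrix ([row_pos_stochastic_factor]). So it suffices
    that the whole product is of this kind: the class [row_pos_mx] contains the identity and is
    stable under products ([row_pos_mulmx]) and under positive column scaling ([row_pos_mul_diag]).
    Rows are normalised only once, at the end. *)

Definition row_pos_mx (R : realType) (m : nat) (A : 'M[R]_m) : Prop :=
  nonneg_mx A /\ (forall i, exists k, 0 < A i k).

Lemma row_pos_mx1 (R : realType) (m : nat) : row_pos_mx (1%:M : 'M[R]_m).
Proof.
split=> [i j|i]; first by rewrite mxE ler0n.
by exists i; rewrite mxE eqxx ltr01.
Qed.

(** Chaining a positive entry [A i k] with a positive entry [B k l] gives a positive term in the sum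
    for entry [(i, l)]; non-negativity rules out cancellation by the other terms. *)
Lemma row_pos_mulmx (R : realType) (m : nat) (A B : 'M[R]_m) :
  row_pos_mx A -> row_pos_mx B -> row_pos_mx (A *m B).
Proof.
move=> [A0 Apos] [B0 Bpos]; split=> [i j|i].
  by rewrite mxE; apply: sumr_ge0 => k _; apply: mulr_ge0.
have [k Aik] := Apos i; have [l Bkl] := Bpos k; exists l.
rewrite mxE (bigD1 k) //= ltr_wpDr ?mulr_gt0 //.
by apply: sumr_ge0 => k' _; apply: mulr_ge0.
Qed.

Lemma row_pos_mul_diag (R : realType) (m : nat) (A : 'M[R]_m) (u : 'rV[R]_m) :
  row_pos_mx A -> pos_vec u -> row_pos_mx (A *m diag_mx u).
Proof.
move=> [A0 Apos] u_gt0; split=> [i j|i].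
  by rewrite mul_mx_diag mxE mulr_ge0 // ltW.
by have [k Aik] := Apos i; exists k; rewrite mul_mx_diag mxE mulr_gt0.
Qed.

Lemma row_pos_stochastic_factor (R : realType) (m : nat) (A : 'M[R]_m) :
  row_pos_mx A -> exists (v : 'rV[R]_m) (P : 'M[R]_m),
    [/\ pos_vec v, stochastic P & A = diag_mx v *m P].
Proof.
move=> [A0 Apos]; pose v : 'rV[R]_m := \row_i \sum_j A i j.
have v_gt0 : pos_vec v.
  move=> i; rewrite mxE; have [k Aik] := Apos i.
  by rewrite (bigD1 k) //= ltr_wpDr // sumr_ge0.
(* The second witness is [A] with row [i] divided by its sum [v 0 i], which is invertible because it
   is positive. *)
exists v, (\matrix_(i, j) ((v 0 i)^-1 * A i j)); split=> //.
  split=> [i j|i]; first by rewrite mxE mulr_ge0 // invr_ge0 ltW.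
  under eq_bigr do rewrite mxE.
  have := v_gt0 i; rewrite -mulr_sumr [v 0 i]mxE => s_gt0.
  by rewrite mulVf // gt_eqF.
apply/matrixP=> i j; rewrite mul_diag_mx [RHS]mxE [X in _ * X]mxE.
by rewrite mulVKf // gt_eqF.
Qed.

Theorem theorem1 (R : realType) (m n : nat) (hm : (1 <= m)%N) (hn : (1 <= n)%N)
  (A : 'I_n -> 'M[R]_m) (u : 'I_n -> 'rV[R]_m)
  (hA : forall i, nonneg_mx (A i))
  (hrow : forall i (j : 'I_m), exists k : 'I_m, A i j k != 0)
  (hu : forall i, pos_vec (u i)) :
  exists (v : 'rV[R]_m) (P : 'M[R]_m),
    [/\ pos_vec v, stochastic P &
        \prod_(i < n) (A i *m diag_mx (u i)) = diag_mx v *m P].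
Proof.
apply: row_pos_stochastic_factor.
apply: (big_ind (@row_pos_mx R m)) => [||i _]; first exact: row_pos_mx1.
  exact: row_pos_mulmx.
apply: row_pos_mul_diag => //; split=> // j.
(* A non-zero entry of a non-negative matrix is positive. *)
by have [k Ajk] := hrow i j; exists k; rewrite lt0r Ajk hA.
Qed.
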